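(* If a theory $T$ has VC-density one, then $T$ is dp-minimal.
   Context: For a finite set of formulae $\Delta(\bar x,\bar y)$, with $\bar y$ regarded as the parameter variables, and a set $A$ of $|\bar y|$-tuples from a model of $T$, $S^\Delta(A)$ denotes the set of complete $\Delta$-types (in $\bar x$) with parameters from $A$. $T$ has VC-density one if for any finite set of formulae $\Delta(\bar x,\bar y)$ there is a constant $C$ so that for any finite (nonempty) set $A$ of $|\bar y|$-tuples, $|S^\Delta(A)|\le C|A|^{|\bar x|}$. An ICT pattern in a structure $M$ consists of formulae $\phi(x,\bar y)$, $\psi(x,\bar y)$, with $x$ a single variable and $\bar y$ a finite tuple of variables, and sequences $(\bar a_i)_{i\in\omega}$, $(\bar b_i)_{i\in\omega}$ of tuples from $M$ such that for all $i,j\in\omega$ the set $\{\phi(x,\bar a_i),\psi(x,\bar b_j)\}\cup\{\neg\phi(x,\bar a_l):l\neq i\}\cup\{\neg\psi(x,\bar b_k):k\neq j\}$ is consistent (realized in some elementary extension of $M$). A theory is dp-minimal if there is no ICT pattern in any of its models. *)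

(* Defs.v *)
From mathcomp Require Import all_boot.
From mathcomp Require Import classical_sets cardinality.

Set Implicit Arguments.
Unset Strict Implicit.
Unset Printing Implicit Defensive.

Local Open Scope classical_set_scope.
Local Open Scope card_scope.

Record language := Language {
  func_symb : Type;
  func_arity : func_symb -> nat;
  rel_symb : Type;
  rel_arity : rel_symb -> nat
}.

(* Well-scoped syntax: [term L n] and [formula L n] have their free variables  *)
(* among 'I_n.  A quantifier binds variable 0 and shifts the free variables    *)
(* up by one.                                                                  *)
Inductive term (L : language) (n : nat) : Type :=
| Var of 'I_n
| App (f : func_symb L) of ('I_(func_arity f) -> term L n).

Inductive formula (L : language) : nat -> Type :=
| FEq n of term L n & term L n : formula L n
| FRel n (r : rel_symb L) of ('I_(rel_arity r) -> term L n) : formula L n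
| FNeg n of formula L n : formula L n
| FAnd n of formula L n & formula L n : formula L n
| FEx n of formula L n.+1 : formula L n.

Definition theory (L : language) := set (formula L 0).

Record structure (L : language) := Structure {
  carrier :> Type;
  carrier_inhabited : inhabited carrier;
  func_interp : forall f : func_symb L, (func_arity f).-tuple carrier -> carrier;
  rel_interp : forall r : rel_symb L, (rel_arity r).-tuple carrier -> Prop
}.

Fixpoint eval (L : language) (M : structure L) (n : nat) (v : n.-tuple M)
    (t : term L n) : M :=
  match t with
  | Var i => tnth v i
  | App f ts => func_interp [tuple eval v (ts i) | i < func_arity f]
  end.

Fixpoint sat (L : language) (M : structure L) (n : nat) (phi : formula L n) :
    n.-tuple M -> Prop :=
  match phi with
  | FEq _ s t => fun v => eval v s = eval v t
  | FRel _ r ts => fun v => rel_interp [tuple eval v (ts i) | i < rel_arity r]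
  | FNeg _ psi => fun v => ~ sat psi v
  | FAnd _ psi chi => fun v => sat psi v /\ sat chi v
  | FEx _ psi => fun v => exists c : M, sat psi [tuple of c :: v]
  end.

Definition model (L : language) (T : theory L) (M : structure L) : Prop :=
  forall sigma, T sigma -> sat (M := M) sigma [tuple].

Definition elementary (L : language) (M N : structure L) (f : M -> N) : Prop :=
  forall (n : nat) (phi : formula L n) (v : n.-tuple M),
    sat phi v <-> sat phi (map_tuple f v).

(* The pair (phi, a) stands for the formula phi(x, a) with parameters in M,    *)
(* where the first n variables of phi are x and the last m ones are y.         *)
Definition pformula (L : language) (M : structure L) (n m : nat) : Type :=
  (formula L (n + m) * m.-tuple M)%type.

(* An elementary extension of M is given as an elementary embedding M -> N.    *)
Definition consistent (L : language) (M : structure L) (n m : nat)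
    (p : set (pformula M n m)) : Prop :=
  exists (N : structure L) (f : M -> N) (c : n.-tuple N), elementary f /\
    forall phi a, p (phi, a) -> sat phi [tuple of c ++ map_tuple f a].

(* S^Delta(A): a complete Delta-type is the set of the formulae with           *)
(* parameters that it contains.                                                *)
Definition delta_types (L : language) (M : structure L) (n m : nat)
    (Delta : set (formula L (n + m))) (A : set (m.-tuple M)) :
    set (set (pformula M n m)) :=
  [set p | [/\ consistent p,
    p `<=` Delta `*` A `|` [set (FNeg q.1, q.2) | q in Delta `*` A]
    & forall phi a, Delta phi -> A a -> p (phi, a) \/ p (FNeg phi, a)]].

(* The constant C depends on T and Delta only, not on the model containing A.  *)
Definition vc_density_one (L : language) (T : theory L) : Prop :=
  forall (n m : nat) (Delta : set (formula L (n + m))), finite_set Delta ->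
  exists C : nat, forall M : structure L, model T M ->
  forall (A : set (m.-tuple M)) (k : nat), A !=set0 -> A #= `I_k ->
    delta_types Delta A #<= `I_(C * k ^ n).

Definition ict_pattern (L : language) (M : structure L) (m : nat)
    (phi psi : formula L (1 + m)) (a b : nat -> m.-tuple M) : Prop :=
  forall i j : nat, consistent (n := 1)
    ([set (phi, a i); (psi, b j)]
     `|` [set (FNeg phi, a l) | l in [set l | l <> i]]
     `|` [set (FNeg psi, b k) | k in [set k | k <> j]]).

Definition dp_minimal (L : language) (T : theory L) : Prop :=
  forall M : structure L, model T M ->
  ~ exists (m : nat) (phi psi : formula L (1 + m)) (a b : nat -> m.-tuple M),
      ict_pattern phi psi a b.

(* Main.v *)
Require Import Defs.
From mathcomp Require Import all_boot.
From mathcomp Require Import boolp classical_sets cardinality.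

Set Implicit Arguments.
Unset Strict Implicit.
Unset Printing Implicit Defensive.

Local Open Scope classical_set_scope.
Local Open Scope card_scope.

(** Why VC-density one excludes ICT patterns.  Suppose that [phi], [psi],
    [a], [b] form an ICT pattern.  Take [Delta = {phi, psi}] and let the
    parameter set [A] consist of the first [N] of the [a i] and the first [N]
    of the [b j].  For [i, j < N] the [(i, j)]-th set of the pattern extends
    to a complete [Delta]-type over [A] ([consistent_extends_to_delta_type]).
    In that type, [a i] is the only row parameter at which [phi] holds and
    [b j] the only column parameter at which [psi] holds, so distinct pairs
    give distinct types ([ict_pattern_many_delta_types]).  Hence there are at
    least [N ^ 2] types over at most [2 N] parameters.  As [x] is a single
    variable, VC-density one allows at most [C * 2 N] of them, which fails as
    soon as [N > 2 C]. *)

Section DeltaTypes.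
Variables (L : language) (M : structure L) (n m : nat).
Implicit Types (p q : set (pformula M n m)) (Delta : set (formula L (n + m))).
Implicit Types (A : set (m.-tuple M)).

Lemma consistent_not_both p (phi : formula L (n + m)) a :
  consistent p -> p (phi, a) -> ~ p (FNeg phi, a).
Proof. by move=> [N [f [c [_ pc]]]] /pc pos /pc; apply. Qed.

(** A tuple [c] realizing [p] decides every formula over [A]; the extension
    is the [Delta]-type of [c] over [A]. *)
Lemma consistent_extends_to_delta_type p Delta A :
  consistent p ->
  exists2 q, delta_types Delta A q &
    forall phi a, Delta phi -> A a ->
      (p (phi, a) -> q (phi, a)) /\ (p (FNeg phi, a) -> q (FNeg phi, a)).
Proof.
move=> [N [f [c [fE pc]]]].
pose dom : set (pformula M n m) :=
  Delta `*` A `|` [set (FNeg r.1, r.2) | r in Delta `*` A].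
pose holds (r : pformula M n m) := sat r.1 [tuple of c ++ map_tuple f r.2].
have domP phi a : Delta phi -> A a -> dom (phi, a) /\ dom (FNeg phi, a).
  by move=> Dphi Aa; split; [left | right; exists (phi, a)].
exists [set r | dom r /\ holds r].
  split=> [|r [] //|phi a Dphi Aa].
    by exists N, f, c; split=> // phi a [].
  have [dpos dneg] := domP _ _ Dphi Aa.
  by have [h|h] := EM (holds (phi, a)); [left | right].
move=> phi a Dphi Aa; have [dpos dneg] := domP _ _ Dphi Aa.
by split=> /pc.
Qed.

End DeltaTypes.

Lemma ict_pattern_many_delta_types (L : language) (M : structure L) (m : nat)
    (phi psi : formula L (1 + m)) (a b : nat -> m.-tuple M) (N : nat)
    (A : set (m.-tuple M)) :
  ict_pattern phi psi a b ->
  (forall i, i < N -> A (a i)) -> (forall j, j < N -> A (b j)) ->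
  `I_(N * N) #<= delta_types [set phi; psi] A.
Proof.
move=> ict Aa Ab; set Delta := [set phi; psi].
have Dphi : Delta phi by left.
have Dpsi : Delta psi by right.
have /choice[q qP] : forall ij : nat * nat, exists q, delta_types Delta A q /\
    [/\ ij.1 < N -> q (phi, a ij.1), ij.2 < N -> q (psi, b ij.2),
      forall l, l < N -> l <> ij.1 -> q (FNeg phi, a l) &
      forall k, k < N -> k <> ij.2 -> q (FNeg psi, b k)].
  move=> [i j] /=.
  have [q qtype qp] := consistent_extends_to_delta_type Delta A (ict i j).
  exists q; split=> //; split.
  - by move=> iN; apply: (qp _ _ Dphi (Aa _ iN)).1; left; left; left.
  - by move=> jN; apply: (qp _ _ Dpsi (Ab _ jN)).1; left; left; right.
  - by move=> l lN li; apply: (qp _ _ Dphi (Aa _ lN)).2; left; right; exists l.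
  - by move=> k kN kj; apply: (qp _ _ Dpsi (Ab _ kN)).2; right; exists k.
(* Numbers below N * N encode pairs of indices as quotient and remainder. *)
pose ij t := (t %/ N, t %% N).
have ijN t : t < N * N -> (ij t).1 < N /\ (ij t).2 < N.
  move=> tN; have N0 : 0 < N by case: N tN {Aa Ab qP ij}.
  by rewrite ltn_divLR // ltn_mod.
have inj : {in `I_(N * N) &, injective (q \o ij)}.
  move=> s t /[!inE] /ijN[s1 s2] /ijN[t1 t2] /= qst.
  have [[qcons _ _] [qa qb _ _]] := qP (ij s).
  have [_ [_ _ qna qnb]] := qP (ij t).
  have e1 : (ij s).1 = (ij t).1.
    apply: contrapT => ne; apply: (consistent_not_both qcons (qa s1)).
    by rewrite qst; apply: qna.
  have e2 : (ij s).2 = (ij t).2.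
    apply: contrapT => ne; apply: (consistent_not_both qcons (qb s2)).
    by rewrite qst; apply: qnb.
  by rewrite /= in e1 e2; rewrite (divn_eq s N) (divn_eq t N) e1 e2.
rewrite -(card_le_eql (inj_card_eq inj)); apply: subset_card_le.
by move=> _ [t _ <-]; have [] := qP (ij t).
Qed.

Theorem proposition3p2 (L : language) (T : theory L) :
  vc_density_one T -> dp_minimal T.
Proof.
move=> vc1 M MT [m [phi [psi [a [b ict]]]]].
have [C CP] := vc1 1%N m [set phi; psi] (finite_set2 _ _).
pose N := (2 * C).+1.
pose c t := if t < N then a t else b (t - N).
pose A := c @` `I_(2 * N).
have Aa i : i < N -> A (a i).
  move=> iN; exists i; last by rewrite /c iN.
  by rewrite /= mul2n -addnn ltn_addr.
have Ab j : j < N -> A (b j).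
  move=> jN; exists (N + j); last by rewrite /c ltnNge leq_addr addKn.
  by rewrite /= mul2n -addnn ltn_add2l.
have [k Ak] : finite_set A by apply: finite_image; exact: finite_II.
have kN : k <= 2 * N.
  by rewrite -card_le_II -(card_le_eql Ak) card_image_le.
have A0 : A !=set0 by exists (a 0); apply: Aa.
have := card_le_trans (ict_pattern_many_delta_types ict Aa Ab) (CP M MT A k A0 Ak).
rewrite card_le_II expn1 leqNgt => /negP; apply.
(* C * k <= C * (2 * N) = (N - 1) * N *)
apply: (@leq_ltn_trans (2 * C * N)); last by rewrite ltn_pmul2r.
by rewrite (mulnC 2) -mulnA leq_mul2l kN orbT.
Qed.
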